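(* Let $\mathbb{K}$ be the class of all relational frames, $\mathbb{R}$ the class of reflexive frames, $\mathbb{P}$ (resp. $\mathbb{S}$) the class of pseudosymmetric (resp. strongly pseudosymmetric) frames, $\mathbb{PR}$ (resp. $\mathbb{SR}$) the class of pseudosymmetric (resp. strongly pseudosymmetric) reflexive frames, and $\mathbb{WCR}$ the class of weakly compossible reflexive frames. Then for all $\varphi,\psi\in\mathcal{L}$: (1) $\varphi\vdash_\mathsf{pre}\psi$ iff $\varphi\vDash_\mathbb{K}\psi$; (2) $\varphi\vdash_\mathsf{pro}\psi$ iff $\varphi\vDash_\mathbb{R}\psi$; (3) $\varphi\vdash_\mathsf{para}\psi$ iff $\varphi\vDash_\mathbb{P}\psi$, and also iff $\varphi\vDash_\mathbb{S}\psi$; (4) $\varphi\vdash_\mathsf{F}\psi$ iff $\varphi\vDash_\mathbb{PR}\psi$, and also iff $\varphi\vDash_\mathbb{SR}\psi$; (5) $\varphi\vdash_\mathsf{psu}\psi$ iff $\varphi\vDash_\mathbb{WCR}\psi$.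
   Context: Language: $\mathcal{L}$ given by $\varphi::= p\mid\neg\varphi\mid(\varphi\wedge\varphi)\mid(\varphi\vee\varphi)$, $p$ in a nonempty set $\mathsf{Prop}$; fix $p_0\in\mathsf{Prop}$ and set $\bot:=(p_0\wedge\neg p_0)$. Logics: an intro-elim logic is $\vdash\subseteq\mathcal{L}\times\mathcal{L}$ satisfying (1) $\varphi\vdash\varphi$; (2) $\varphi\wedge\psi\vdash\varphi$; (3) $\varphi\wedge\psi\vdash\psi$; (4) $\varphi\vdash\varphi\vee\psi$; (5) $\varphi\vdash\psi\vee\varphi$; (6) $\varphi\vdash\neg\neg\varphi$; (7) $\varphi\wedge\neg\varphi\vdash\psi$; (8) if $\varphi\vdash\psi$ and $\psi\vdash\chi$ then $\varphi\vdash\chi$; (9) if $\varphi\vdash\psi$ and $\varphi\vdash\chi$ then $\varphi\vdash\psi\wedge\chi$; (10) if $\varphi\vdash\chi$ and $\psi\vdash\chi$ then $\varphi\vee\psi\vdash\chi$; (11) if $\varphi\vdash\psi$ then $\neg\psi\vdash\neg\varphi$. A prelogic satisfies all conditions except (6) and (7); a protologic satisfies all conditions but with (6) replaced by $\psi\vdash\neg(\varphi\wedge\neg\varphi)$; a paraconsistent intro-elim logic satisfies all conditions except (7); a pseudocomplementary logic is an intro-elim logic additionally satisfying: if $\varphi\wedge\psi\vdash\bot$ then $\varphi\vdash\neg\psi$. $\vdash_\mathsf{pre},\vdash_\mathsf{pro},\vdash_\mathsf{para},\vdash_\mathsf{psu}$ are the smallest prelogic, protologic, paraconsistent intro-elim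 logic, and pseudocomplementary logic, respectively. $\vdash_\mathsf{F}$ is defined by Fitch-style proofs: finite sequences whose first entry is a formula and whose later entries are formulas or proofs; the set of proofs is the smallest set containing $\langle\varphi\rangle$ for each formula and closed under, for a proof $\langle\sigma_1,\dots,\sigma_n\rangle$ and $1\le i,j\le n$: appending any proof $\tau$; ($\wedge$I) appending $\sigma_i\wedge\sigma_j$ for formulas $\sigma_i,\sigma_j$; ($\wedge$E) if $\sigma_i=\varphi\wedge\psi$, appending $\varphi$ or $\psi$; ($\vee$I) if $\sigma_i$ is a formula, appending $\sigma_i\vee\varphi$ or $\varphi\vee\sigma_i$ for any $\varphi$; ($\vee$E) if $\sigma_i=\varphi\vee\psi$, $\sigma_{n-1}$ is a sequence beginning with $\varphi$ and ending with $\chi$, and $\sigma_n$ is a sequence beginning with $\psi$ and ending with $\chi$, appending $\chi$; ($\neg$I) if $\sigma_i$ is a formula $\psi$ and $\sigma_n$ is a sequence beginning with $\varphi$ and ending with $\neg\psi$, appending $\neg\varphi$; ($\neg$E) if $\sigma_i=\varphi$ and $\sigma_j=\neg\varphi$, appending any formula $\psi$. $\varphi\vdash_\mathsf{F}\psi$ iff some proof has first entry $\varphi$ and last entry $\psi$. Semantics: a relational frame is $(X,\vartriangleleft)$ with $X$ nonempty, $\vartriangleleft\subseteq X\times X$; write $y\vartriangleright x$ for $x\vartriangleleft y$. $c_\vartriangleleft(A)=\{x\mid\forall x'\vartriangleleft x\ \exists x''\vartriangleright x':x''\in A\}$. A model is $(X,\vartriangleleft,V)$ where $V(p)$ is a set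 with $c_\vartriangleleft(V(p))=V(p)$. Forcing: $x\Vdash p$ iff $x\in V(p)$; $x\Vdash\neg\varphi$ iff for all $x'\vartriangleleft x$, $x'\nVdash\varphi$; $x\Vdash\varphi\wedge\psi$ iff $x\Vdash\varphi$ and $x\Vdash\psi$; $x\Vdash\varphi\vee\psi$ iff $\forall x'\vartriangleleft x\ \exists x''\vartriangleright x'$: $x''\Vdash\varphi$ or $x''\Vdash\psi$. For a class $\mathbb{C}$ of frames, $\varphi\vDash_\mathbb{C}\psi$ iff for every model based on a frame in $\mathbb{C}$ and every state $x$, $x\Vdash\varphi$ implies $x\Vdash\psi$. $x$ is absurd if no $y$ satisfies $y\vartriangleleft x$; $x$ pre-refines $y$ if $z\vartriangleleft x$ implies $z\vartriangleleft y$ for all $z$. A frame is pseudosymmetric if for all $x$ and $y\vartriangleleft x$ there is $z\vartriangleleft y$ pre-refining $x$; strongly pseudosymmetric if for all $x$ and $y\vartriangleleft x$ there is $z\vartriangleleft y$ such that $z$ pre-refines $x$ and $x$ pre-refines $z$; weakly compossible if for all $x$ and $y\vartriangleleft x$ there is a non-absurd $z$ pre-refining both $y$ and $x$. *)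

(* Defs.v *)
From Stdlib Require Import List Relations.Relation_Definitions.
Import ListNotations.

Set Implicit Arguments.
Unset Strict Implicit.

Inductive form (Atom : Type) : Type :=
| Var (p : Atom)
| Neg (phi : form Atom)
| And (phi psi : form Atom)
| Or (phi psi : form Atom).

Definition Bot (Atom : Type) (p0 : Atom) : form Atom :=
  And (Var p0) (Neg (Var p0)).

Section Logics.
Variable Atom : Type.
Implicit Types phi psi chi : form Atom.

Record prelogic (D : relation (form Atom)) : Prop := {
  D_refl : forall phi, D phi phi;
  D_and_l : forall phi psi, D (And phi psi) phi;
  D_and_r : forall phi psi, D (And phi psi) psi;
  D_or_l : forall phi psi, D phi (Or phi psi);
  D_or_r : forall phi psi, D phi (Or psi phi);
  D_trans : forall phi psi chi, D phi psi -> D psi chi -> D phi chi;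
  D_and_intro : forall phi psi chi,
    D phi psi -> D phi chi -> D phi (And psi chi);
  D_or_elim : forall phi psi chi,
    D phi chi -> D psi chi -> D (Or phi psi) chi;
  D_contra : forall phi psi, D phi psi -> D (Neg psi) (Neg phi)
}.

Definition dni (D : relation (form Atom)) : Prop :=
  forall phi, D phi (Neg (Neg phi)).

Definition explosion (D : relation (form Atom)) : Prop :=
  forall phi psi, D (And phi (Neg phi)) psi.

Definition noncontradiction (D : relation (form Atom)) : Prop :=
  forall phi psi, D psi (Neg (And phi (Neg phi))).

Definition protologic (D : relation (form Atom)) : Prop :=
  prelogic D /\ noncontradiction D /\ explosion D.

Definition paraconsistent_intro_elim (D : relation (form Atom)) : Prop :=
  prelogic D /\ dni D.

Definition intro_elim (D : relation (form Atom)) : Prop :=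
  prelogic D /\ dni D /\ explosion D.

Definition pseudocomplementary (p0 : Atom) (D : relation (form Atom)) : Prop :=
  intro_elim D /\
  forall phi psi, D (And phi psi) (Bot p0) -> D phi (Neg psi).

(* All the classes above are closed under arbitrary intersections, so for each
   of them [smallest C] is its least member under inclusion. *)
Definition smallest (C : relation (form Atom) -> Prop) : relation (form Atom) :=
  fun phi psi => forall D, C D -> D phi psi.

Definition entails_pre : relation (form Atom) := smallest prelogic.
Definition entails_pro : relation (form Atom) := smallest protologic.
Definition entails_para : relation (form Atom) :=
  smallest paraconsistent_intro_elim.
Definition entails_psu (p0 : Atom) : relation (form Atom) :=
  smallest (pseudocomplementary p0).

End Logics.

Section Fitch.
Variable Atom : Type.

(* An entry of a Fitch proof is a formula or a subproof. *)
Inductive entry : Type :=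
| Fm (phi : form Atom)
| Sub (s : list entry).

Definition begins_with (s : list entry) (phi : form Atom) : Prop :=
  exists r, s = Fm phi :: r.

Definition ends_with (s : list entry) (phi : form Atom) : Prop :=
  exists r, s = r ++ [Fm phi].

(* In the rules [fitch_or_elim] and [fitch_neg_intro], the subproofs are
   required to be the last entries of the sequence being extended; the formula
   premises can be any of its (top-level) entries. *)
Inductive fitch_proof : list entry -> Prop :=
| fitch_start phi : fitch_proof [Fm phi]
| fitch_sub s t :
    fitch_proof s -> fitch_proof t -> fitch_proof (s ++ [Sub t])
| fitch_and_intro s phi psi :
    fitch_proof s -> In (Fm phi) s -> In (Fm psi) s ->
    fitch_proof (s ++ [Fm (And phi psi)])
| fitch_and_elim_l s phi psi :
    fitch_proof s -> In (Fm (And phi psi)) s -> fitch_proof (s ++ [Fm phi])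
| fitch_and_elim_r s phi psi :
    fitch_proof s -> In (Fm (And phi psi)) s -> fitch_proof (s ++ [Fm psi])
| fitch_or_intro_l s phi psi :
    fitch_proof s -> In (Fm psi) s -> fitch_proof (s ++ [Fm (Or psi phi)])
| fitch_or_intro_r s phi psi :
    fitch_proof s -> In (Fm psi) s -> fitch_proof (s ++ [Fm (Or phi psi)])
| fitch_or_elim s r t1 t2 phi psi chi :
    fitch_proof s -> In (Fm (Or phi psi)) s ->
    s = r ++ [Sub t1; Sub t2] ->
    begins_with t1 phi -> ends_with t1 chi ->
    begins_with t2 psi -> ends_with t2 chi ->
    fitch_proof (s ++ [Fm chi])
| fitch_neg_intro s r t phi psi :
    fitch_proof s -> In (Fm psi) s ->
    s = r ++ [Sub t] ->
    begins_with t phi -> ends_with t (Neg psi) ->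
    fitch_proof (s ++ [Fm (Neg phi)])
| fitch_neg_elim s phi psi :
    fitch_proof s -> In (Fm phi) s -> In (Fm (Neg phi)) s ->
    fitch_proof (s ++ [Fm psi]).

Definition entails_F : relation (form Atom) := fun phi psi =>
  exists s, fitch_proof s /\ begins_with s phi /\ ends_with s psi.

End Fitch.

Record frame : Type := {
  state :> Type;
  state_inhabited : inhabited state;
  tri : relation state
}.
Arguments tri {f}.

Definition closure (F : frame) (A : F -> Prop) : F -> Prop := fun x =>
  forall x', tri x' x -> exists x'', tri x' x'' /\ A x''.

Record model (Atom : Type) : Type := {
  base :> frame;
  val : Atom -> base -> Prop;
  val_closed : forall p x, closure (val p) x <-> val p x
}.

Fixpoint forces (Atom : Type) (M : model Atom) (x : M) (phi : form Atom) : Prop :=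
  match phi with
  | Var p => val p x
  | Neg phi => forall x', tri x' x -> ~ forces x' phi
  | And phi psi => forces x phi /\ forces x psi
  | Or phi psi =>
      forall x', tri x' x ->
        exists x'', tri x' x'' /\ (forces x'' phi \/ forces x'' psi)
  end.

Definition consequence (Atom : Type) (C : frame -> Prop) : relation (form Atom) :=
  fun phi psi => forall M : model Atom, C (base M) ->
    forall x : M, forces x phi -> forces x psi.

Definition absurd (F : frame) (x : F) : Prop := ~ exists y, tri y x.

Definition pre_refines (F : frame) (x y : F) : Prop :=
  forall z, tri z x -> tri z y.

Definition all_frames (F : frame) : Prop := True.

Definition reflexive_frame (F : frame) : Prop := reflexive F tri.

Definition pseudosymmetric (F : frame) : Prop :=
  forall x y : F, tri y x -> exists z, tri z y /\ pre_refines z x.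

Definition strongly_pseudosymmetric (F : frame) : Prop :=
  forall x y : F, tri y x ->
    exists z, tri z y /\ pre_refines z x /\ pre_refines x z.

Definition weakly_compossible (F : frame) : Prop :=
  forall x y : F, tri y x ->
    exists z, ~ absurd z /\ pre_refines z y /\ pre_refines z x.

Definition class_PR (F : frame) : Prop :=
  pseudosymmetric F /\ reflexive_frame F.

Definition class_SR (F : frame) : Prop :=
  strongly_pseudosymmetric F /\ reflexive_frame F.

Definition class_WCR (F : frame) : Prop :=
  weakly_compossible F /\ reflexive_frame F.

(* Main.v *)
(** Every logic [D] in question is complete for a canonical frame whose states
    are pairs [(F, I)] of a [D]-filter and a [D]-ideal of formulas such that
    [phi] in [F] implies [Neg phi] in [I], with [(F', I')] related to [(F, I)]
    when [I'] and [F] are disjoint.  A state forces exactly the formulas in its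
    filter.  A disjunction missing from [F] is refuted by a state whose ideal is
    the principal one below it; a negation [Neg phi] missing from [F] is refuted
    by the principal filter of [phi] paired with the least ideal that it admits.
    Requiring in addition that [F] and [I] be nonempty and disjoint makes the
    frame reflexive, and the remaining frame conditions follow by pairing [F],
    respectively the filter generated by [F] and [F'], with its least ideal. *)
From Stdlib Require Import List Classical.
From Stdlib Require Import Relations.Relation_Definitions.
Require Import Defs.
Import ListNotations.

Set Implicit Arguments.
Unset Strict Implicit.

(** * Soundness of the forcing semantics *)

Section Soundness.
Variable Atom : Type.
Implicit Types phi psi chi : form Atom.

(** Valuations are closed by assumption, and the clauses for [Neg] and [Or] quantify over the
    predecessors [y] of [x], so a state [z] above [y] passes its property at [y] on to [x]. *)
Lemma forces_closed (M : model Atom) phi (x : M) :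
  closure (fun y : M => forces y phi) x -> forces x phi.
Proof.
  revert x. induction phi as [p|phi IH|phi IH psi IH'|phi IH psi IH']; intros x Hx.
  - apply val_closed. exact Hx.
  - intros y Hy Hphi. destruct (Hx y Hy) as [z [Hz Hn]]. exact (Hn y Hz Hphi).
  - split; [apply IH | apply IH']; intros y Hy;
      destruct (Hx y Hy) as [z [Hz [H1 H2]]]; eauto.
  - intros y Hy. destruct (Hx y Hy) as [z [Hz Ho]]. exact (Ho y Hz).
Qed.

(** Here [x] itself witnesses that [y] lies in the closure of the truth set. *)
Lemma forces_pre_refines (M : model Atom) phi (x y : M) :
  pre_refines y x -> forces x phi -> forces y phi.
Proof.
  intros Hyx Hx. apply forces_closed. intros z Hz. exists x. auto.
Qed.

(** Soundness of a smallest logic follows once consequence is itself a logic of that kind. Among the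
    conditions here, disjunction elimination is the one that uses closedness of truth sets. *)
Lemma consequence_prelogic (C : frame -> Prop) : prelogic (consequence (Atom := Atom) C).
Proof.
  split; unfold consequence; simpl.
  - auto.
  - intros phi psi M _ x [H _]. exact H.
  - intros phi psi M _ x [_ H]. exact H.
  - intros phi psi M _ x H y Hy. eauto.
  - intros phi psi M _ x H y Hy. eauto.
  - auto.
  - auto.
  - intros phi psi chi H1 H2 M HM x Hx. apply forces_closed. intros y Hy.
    destruct (Hx y Hy) as [z [Hz [H|H]]]; exists z; auto.
  - intros phi psi H M HM x Hx y Hy Hphi. exact (Hx y Hy (H M HM y Hphi)).
Qed.

Lemma consequence_noncontradiction (C : frame -> Prop) :
  (forall F, C F -> reflexive_frame F) ->
  noncontradiction (consequence (Atom := Atom) C).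
Proof.
  intros HC phi psi M HM x _ y _ [H1 H2]. exact (H2 y (HC _ HM y) H1).
Qed.

Lemma consequence_explosion (C : frame -> Prop) :
  (forall F, C F -> reflexive_frame F) ->
  explosion (consequence (Atom := Atom) C).
Proof.
  intros HC phi psi M HM x [H1 H2]. destruct (H2 x (HC _ HM x) H1).
Qed.

Lemma consequence_dni (C : frame -> Prop) :
  (forall F, C F -> pseudosymmetric F) -> dni (consequence (Atom := Atom) C).
Proof.
  intros HC phi M HM x Hx y Hy Hn.
  destruct (HC _ HM x y Hy) as [z [Hz Hr]].
  exact (Hn z Hz (forces_pre_refines Hr Hx)).
Qed.

Lemma consequence_intro_elim (C : frame -> Prop) :
  (forall F, C F -> class_PR F) -> intro_elim (consequence (Atom := Atom) C).
Proof.
  intros HC. split; [apply consequence_prelogic|split].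
  - apply consequence_dni. intros F HF. apply (HC F HF).
  - apply consequence_explosion. intros F HF. apply (HC F HF).
Qed.

Lemma class_WCR_PR (F : frame) : class_WCR F -> class_PR F.
Proof.
  intros [Hw Hr]. split; [|exact Hr]. intros x y Hy.
  destruct (Hw x y Hy) as [z [_ [Hzy Hzx]]].
  exists z. split; [exact (Hzy z (Hr z)) | exact Hzx].
Qed.

Lemma class_SR_PR (F : frame) : class_SR F -> class_PR F.
Proof.
  intros [Hs Hr]. split; [|exact Hr]. intros x y Hy.
  destruct (Hs x y Hy) as [z [Hz [Hzx _]]]. eauto.
Qed.

(** A common pre-refinement of [x] and [y] would force [phi] and [psi], hence [Bot p0], which no
    state of a reflexive frame forces. *)
Lemma consequence_pseudocomplementary (p0 : Atom) :
  pseudocomplementary p0 (consequence class_WCR).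
Proof.
  split; [exact (consequence_intro_elim class_WCR_PR)|].
  intros phi psi H M HM x Hx y Hy Hpsi.
  pose proof HM as [Hw Hr]. destruct (Hw x y Hy) as [z [_ [Hzy Hzx]]].
  destruct (H M HM z) as [H1 H2].
  - split; [exact (forces_pre_refines Hzx Hx) | exact (forces_pre_refines Hzy Hpsi)].
  - exact (H2 z (Hr z) H1).
Qed.

Lemma consequence_subclass (C C' : frame -> Prop) phi psi :
  (forall F, C F -> C' F) -> consequence C' phi psi -> consequence C phi psi.
Proof. intros HC H M HM. apply H. auto. Qed.

End Soundness.

(** * Canonical models and the truth lemma *)

Section Completeness.
Variable Atom : Type.
Variable D : relation (form Atom).
Hypothesis HD : prelogic D.
Implicit Types phi psi chi : form Atom.
Implicit Types F I : form Atom -> Prop.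

(* Filters and ideals may be empty. *)
Definition is_filter F : Prop :=
  (forall phi psi, F phi -> D phi psi -> F psi) /\
  (forall phi psi, F phi -> F psi -> F (And phi psi)).

Definition is_ideal I : Prop :=
  (forall phi psi, I psi -> D phi psi -> I phi) /\
  (forall phi psi, I phi -> I psi -> I (Or phi psi)).

Definition neg_ideal F : form Atom -> Prop :=
  fun psi => exists phi, F phi /\ D psi (Neg phi).

Lemma filter_principal phi : is_filter (D phi).
Proof.
  split; intros psi chi H1 H2; [exact (D_trans HD H1 H2) | exact (D_and_intro HD H1 H2)].
Qed.

Lemma ideal_principal psi : is_ideal (fun phi => D phi psi).
Proof.
  split; intros phi chi H1 H2; [exact (D_trans HD H2 H1) | exact (D_or_elim HD H1 H2)].
Qed.

(** By De Morgan, [Neg a] and [Neg b] both entail [Neg (And a b)], so the negations of a filter need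
    no further closure under [Or]. *)
Lemma neg_ideal_ideal F : is_filter F -> is_ideal (neg_ideal F).
Proof.
  intros [Hup Hand]. split.
  - intros phi psi [chi [H1 H2]] H. exists chi. split; [|exact (D_trans HD H H2)]. exact H1.
  - intros phi psi [a [Ha Ha']] [b [Hb Hb']]. exists (And a b). split; [auto|].
    apply (D_or_elim HD).
    + exact (D_trans HD Ha' (D_contra HD (D_and_l HD a b))).
    + exact (D_trans HD Hb' (D_contra HD (D_and_r HD a b))).
Qed.

Lemma neg_ideal_neg F phi : F phi -> neg_ideal F (Neg phi).
Proof. intros H. exists phi. split; [exact H | exact (D_refl HD _)]. Qed.

(* [Q] is instantiated with [True] to obtain arbitrary canonical frames, and with
   disjointness and nonemptiness to obtain reflexive ones. *)
Variable Q : (form Atom -> Prop) -> (form Atom -> Prop) -> Prop.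

Record canonical_state : Type := {
  filt : form Atom -> Prop;
  idl : form Atom -> Prop;
  filt_filter : is_filter filt;
  idl_ideal : is_ideal idl;
  filt_neg_idl : forall phi, filt phi -> idl (Neg phi);
  filt_idl : Q filt idl
}.

Definition state_of_filter F (HF : is_filter F) (HQ : Q F (neg_ideal F)) : canonical_state :=
  {| filt := F; idl := neg_ideal F; filt_filter := HF;
     idl_ideal := neg_ideal_ideal HF;
     filt_neg_idl := neg_ideal_neg (F := F); filt_idl := HQ |}.

Definition canonical_frame (w : canonical_state) : frame :=
  {| state := canonical_state; state_inhabited := inhabits w;
     tri := fun y x => forall phi, idl y phi -> filt x phi -> False |}.

(** The filter of a state alone determines its predecessors. *)
Lemma canonical_pre_refines (w : canonical_state) (x y : canonical_frame w) :
  (forall phi, filt x phi -> filt y phi) -> pre_refines y x.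
Proof. intros H z Hz phi H1 H2. exact (Hz phi H1 (H phi H2)). Qed.

(** States that the truth lemma needs: the first hypothesis serves closedness, the other two admit
    the principal filters used for [Or] and [Neg]. The filter of [y] is left open because its choice
    depends on [Q]. *)
Hypothesis ex_principal_ideal : forall (x : canonical_state) phi, ~ filt x phi ->
  exists y : canonical_state, forall psi, idl y psi <-> D psi phi.
Hypothesis Q_notin_idl : forall (x : canonical_state) phi, ~ idl x phi ->
  Q (D phi) (neg_ideal (D phi)).
Hypothesis Q_neg_notin_filt : forall (x : canonical_state) phi, ~ filt x (Neg phi) ->
  Q (D phi) (neg_ideal (D phi)).

(** If [filt x] omits [phi], the state with the principal ideal of [phi] is a predecessor of [x],
    yet no state above it contains [phi]. All formulas are covered because the disjunction case of
    the truth lemma reuses this. *)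
Lemma canonical_val_closed (w : canonical_state) phi (x : canonical_frame w) :
  closure (fun y : canonical_frame w => filt y phi) x <-> filt x phi.
Proof.
  split.
  - intros Hx. apply NNPP. intros Hn.
    destruct (ex_principal_ideal Hn) as [y Hy].
    destruct (Hx y) as [z [Hz Hz']].
    + intros psi H1 H2. apply Hn. apply Hy in H1. exact (proj1 (filt_filter x) _ _ H2 H1).
    + exact (Hz phi (proj2 (Hy phi) (D_refl HD phi)) Hz').
  - intros Hx y Hy. eauto.
Qed.

Definition canonical_model (w : canonical_state) : model Atom :=
  {| base := canonical_frame w; val := fun p (x : canonical_frame w) => filt x (Var p);
     val_closed := fun p => @canonical_val_closed w (Var p) |}.

Lemma canonical_truth (w : canonical_state) phi (x : canonical_model w) :
  forces x phi <-> filt x phi.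
Proof.
  revert x. induction phi as [p|phi IH|phi IH psi IH'|phi IH psi IH']; intros x; simpl.
  - reflexivity.
  - split.
    + intros Hx. apply NNPP. intros Hn.
      pose (y := state_of_filter (filter_principal phi) (Q_neg_notin_filt Hn)).
      apply (Hx y).
      (* A clash puts into [filt x] some [psi] entailing [Neg chi], where [phi] entails [chi]; then
         [Neg phi] is in [filt x] too. *)
      * intros psi [chi [H1 H2]] H3. apply Hn.
        exact (proj1 (filt_filter x) _ _ H3 (D_trans HD H2 (D_contra HD H1))).
      * apply IH. exact (D_refl HD phi).
    + intros Hx y Hy H. apply IH in H. exact (Hy _ (filt_neg_idl H) Hx).
  - rewrite IH, IH'. destruct (filt_filter x) as [Hup Hand]. split.
    + intros [H1 H2]. auto.
    + intros H. split; apply (Hup _ _ H); [exact (D_and_l HD _ _) | exact (D_and_r HD _ _)].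
  - split.
    + intros Hx. apply canonical_val_closed. intros y Hy.
      destruct (Hx y Hy) as [z [Hz Ho]]. exists z. split; [exact Hz|].
      destruct Ho as [H|H]; [apply IH in H | apply IH' in H];
        apply (proj1 (filt_filter z) _ _ H); [exact (D_or_l HD _ _) | exact (D_or_r HD _ _)].
    + intros Hx y Hy.
      (* If [idl y] contained both disjuncts it would contain the disjunction, which is in [filt x].
         So one disjunct is outside [idl y], and its principal filter lies above [y]. *)
      destruct (not_and_or _ _ (fun H => Hy _ (proj2 (idl_ideal y) phi psi (proj1 H) (proj2 H)) Hx))
        as [H|H];
        exists (state_of_filter (filter_principal _) (Q_notin_idl H)); split.
      * intros chi H1 H2. exact (H (proj1 (idl_ideal y) _ _ H1 H2)).
      * left. apply IH. exact (D_refl HD _).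
      * intros chi H1 H2. exact (H (proj1 (idl_ideal y) _ _ H1 H2)).
      * right. apply IH'. exact (D_refl HD _).
Qed.

(** [Q] is asked only under [~ D phi psi], because an explosive [phi] generates the improper filter,
    which disjointness excludes. *)
Lemma canonical_complete (C : frame -> Prop) phi psi :
  (~ D phi psi -> Q (D phi) (neg_ideal (D phi))) ->
  (forall w, C (canonical_frame w)) ->
  consequence C phi psi -> D phi psi.
Proof.
  intros HQ HC H. apply NNPP. intros Hn.
  pose (w := state_of_filter (filter_principal phi) (HQ Hn)).
  apply Hn. apply (canonical_truth psi (w : canonical_model w)).
  apply H; [apply HC|]. apply canonical_truth. exact (D_refl HD phi).
Qed.

End Completeness.

(** * Canonical frame conditions and completeness for each kind of logic *)

Section CanonicalFrameConditions.
Variable Atom : Type.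
Variable D : relation (form Atom).
Implicit Types phi psi : form Atom.
Implicit Types F I : form Atom -> Prop.

(** The witness keeps the filter of [x], so it has exactly the predecessors of [x]. *)
Lemma canonical_strongly_pseudosymmetric
  (Q : (form Atom -> Prop) -> (form Atom -> Prop) -> Prop) (w : canonical_state D Q) :
  prelogic D -> dni D ->
  (forall x : canonical_state D Q, Q (filt x) (neg_ideal D (filt x))) ->
  strongly_pseudosymmetric (canonical_frame w).
Proof.
  intros HD Hdni HQ x y Hy.
  exists (state_of_filter HD (filt_filter x) (HQ x)).
  split; [|split; apply canonical_pre_refines; auto].
  (* Through [psi], [filt y] contains [Neg phi], so [Neg (Neg phi)] is in [idl y], and double
     negation introduction brings [phi] into [idl y]. *)
  intros psi [phi [H1 H2]] H3. apply (Hy phi); [|exact H1].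
  apply (proj1 (idl_ideal y) _ (Neg (Neg phi))); [|exact (Hdni phi)].
  apply filt_neg_idl. exact (proj1 (filt_filter y) _ _ H3 H2).
Qed.

Definition any_pair F I : Prop := True.

Lemma prelogic_complete (C : frame -> Prop) phi psi :
  prelogic D ->
  (forall w : canonical_state D any_pair, C (canonical_frame w)) ->
  consequence C phi psi -> D phi psi.
Proof.
  intros HD. apply (canonical_complete HD); try exact (fun _ => I);
    try exact (fun _ _ _ => I).
  intros _ chi _.
  (* The empty filter meets [filt_neg_idl] vacuously, so any ideal can accompany it. *)
  unshelve eexists {| filt := fun _ => False; idl := fun a => D a chi |}.
  - split; intros a b [].
  - exact (ideal_principal HD chi).
  - intros a [].
  - exact I.
  - reflexivity.
Qed.

(** Disjointness is reflexivity of the canonical relation. A nonempty ideal then leaves a formula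
    outside the filter, and a nonempty filter contains every formula that all formulas entail. *)
Definition disjoint_pair F I : Prop :=
  (exists phi, F phi) /\ (exists phi, I phi) /\ (forall phi, I phi -> F phi -> False).

Lemma canonical_reflexive (w : canonical_state D disjoint_pair) :
  reflexive_frame (canonical_frame w).
Proof. intros x. exact (proj2 (proj2 (filt_idl x))). Qed.

(** A common member entails [Neg b] for some [b] in [F], so [F] contains [b] and [Neg b] and, by
    explosion, [psi]. *)
Lemma disjoint_neg_ideal F psi :
  prelogic D -> explosion D -> is_filter D F -> (exists phi, F phi) -> ~ F psi ->
  disjoint_pair F (neg_ideal D F).
Proof.
  intros HD Hex [Hup Hand] [phi Hphi] Hpsi. split; [eauto|split].
  - exists (Neg phi). exact (neg_ideal_neg HD Hphi).
  - intros a [b [Hb Hab]] Ha. apply Hpsi.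
    exact (Hup _ _ (Hand _ _ Hb (Hup _ _ Ha Hab)) (Hex b psi)).
Qed.

Lemma disjoint_neg_ideal_filt (x : canonical_state D disjoint_pair) :
  prelogic D -> explosion D -> disjoint_pair (filt x) (neg_ideal D (filt x)).
Proof.
  intros HD Hex. destruct (filt_idl x) as [HF [[psi Hpsi] Hdisj]].
  apply (disjoint_neg_ideal HD Hex (filt_filter x) HF (psi := psi)). eauto.
Qed.

Lemma disjoint_neg_ideal_principal phi psi :
  prelogic D -> explosion D -> ~ D phi psi ->
  disjoint_pair (D phi) (neg_ideal D (D phi)).
Proof.
  intros HD Hex. apply (disjoint_neg_ideal HD Hex (filter_principal HD phi)).
  exists phi. exact (D_refl HD phi).
Qed.

Lemma protologic_complete (C : frame -> Prop) phi psi :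
  protologic D ->
  (forall w : canonical_state D disjoint_pair, C (canonical_frame w)) ->
  consequence C phi psi -> D phi psi.
Proof.
  intros [HD [Hnc Hex]]. apply (canonical_complete HD).
  - intros x chi Hchi.
    (* The filter has to be nonempty here, so take the least nonempty one. *)
    unshelve eexists {| filt := fun a => forall b, D b a; idl := fun a => D a chi |}.
    + split; intros a b H1 H2 c; [exact (D_trans HD (H1 c) H2) | exact (D_and_intro HD (H1 c) (H2 c))].
    + exact (ideal_principal HD chi).
    (* As everything entails [a], [Neg a] entails [And a (Neg a)] and hence [chi]. *)
    + intros a Ha.
      apply (D_trans HD (D_and_intro HD (Ha (Neg a)) (D_refl HD (Neg a))) (Hex a chi)).
    + split; [exists (Neg (And chi (Neg chi))); exact (Hnc chi)|split].
      * exists chi. exact (D_refl HD chi).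
      * intros a Ha Ht. destruct (filt_idl x) as [[b Hb] _]. apply Hchi.
        exact (proj1 (filt_filter x) _ _ Hb (D_trans HD (Ht b) Ha)).
    + reflexivity.
  - intros x chi Hchi. destruct (filt_idl x) as [_ [[b Hb] _]].
    apply (disjoint_neg_ideal_principal HD Hex (psi := b)). intros H. apply Hchi.
    exact (proj1 (idl_ideal x) _ _ Hb H).
  - intros x chi Hchi. destruct (filt_idl x) as [[b Hb] _].
    (* If [chi] entailed this contradiction, contraposition and noncontradiction would make [b]
       entail [Neg chi]. *)
    apply (disjoint_neg_ideal_principal HD Hex (psi := And b (Neg b))). intros H. apply Hchi.
    exact (proj1 (filt_filter x) _ _ Hb (D_trans HD (Hnc b b) (D_contra HD H))).
  - exact (disjoint_neg_ideal_principal HD Hex).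
Qed.

(** Explosion into [Neg psi] contraposes to an entailment from [Neg (Neg psi)], which [psi]
    entails. *)
Lemma intro_elim_protologic : intro_elim D -> protologic D.
Proof.
  intros [HD [Hdni Hex]]. split; [exact HD|split; [|exact Hex]].
  intros phi psi. exact (D_trans HD (Hdni psi) (D_contra HD (Hex phi (Neg psi)))).
Qed.

Lemma canonical_SR (w : canonical_state D disjoint_pair) :
  intro_elim D -> class_SR (canonical_frame w).
Proof.
  intros [HD [Hdni Hex]]. split; [|apply canonical_reflexive].
  apply (canonical_strongly_pseudosymmetric HD Hdni). intros x.
  exact (disjoint_neg_ideal_filt x HD Hex).
Qed.

Lemma canonical_WCR (p0 : Atom) (w : canonical_state D disjoint_pair) :
  pseudocomplementary p0 D -> class_WCR (canonical_frame w).
Proof.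
  intros [[HD [Hdni Hex]] Hpsu]. split; [|apply canonical_reflexive].
  intros x y Hy.
  (* The filter generated by both filters: one member from each suffices, as each is closed under
     [And]. *)
  pose (G := fun c => exists a b, filt x a /\ filt y b /\ D (And a b) c).
  assert (HG : is_filter D G).
  { split.
    - intros c d [a [b [Ha [Hb H]]]] Hcd. exists a, b. split; [exact Ha|split; [exact Hb|exact (D_trans HD H Hcd)]].
    - intros c c' [a [b [Ha [Hb H]]]] [a' [b' [Ha' [Hb' H']]]].
      exists (And a a'), (And b b').
      split; [exact (proj2 (filt_filter x) _ _ Ha Ha')|].
      split; [exact (proj2 (filt_filter y) _ _ Hb Hb')|].
      assert (Hx : D (And (And a a') (And b b')) (And a a')) by exact (D_and_l HD _ _).
      assert (Hy' : D (And (And a a') (And b b')) (And b b')) by exact (D_and_r HD _ _).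
      apply (D_and_intro HD).
      + exact (D_trans HD (D_and_intro HD (D_trans HD Hx (D_and_l HD _ _))
                                          (D_trans HD Hy' (D_and_l HD _ _))) H).
      + exact (D_trans HD (D_and_intro HD (D_trans HD Hx (D_and_r HD _ _))
                                          (D_trans HD Hy' (D_and_r HD _ _))) H'). }
  destruct (filt_idl x) as [[a Ha] _]. destruct (filt_idl y) as [[b Hb] _].
  assert (HxG : forall c, filt x c -> G c).
  { intros c Hc. exists c, b. split; [exact Hc|split; [exact Hb|exact (D_and_l HD _ _)]]. }
  assert (HyG : forall c, filt y c -> G c).
  { intros c Hc. exists a, c. split; [exact Ha|split; [exact Hc|exact (D_and_r HD _ _)]]. }
  assert (HQ : disjoint_pair G (neg_ideal D G)).
  { apply (disjoint_neg_ideal HD Hex HG (psi := Bot p0)); [eauto|].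
    intros [c [d [Hc [Hd H]]]]. apply (Hy (Neg d) (filt_neg_idl Hd)).
    exact (proj1 (filt_filter x) _ _ Hc (Hpsu _ _ H)). }
  pose (z := state_of_filter HD HG HQ).
  exists z. split; [|split; apply canonical_pre_refines; assumption].
  intros Habs. apply Habs. exists z. exact (@canonical_reflexive w z).
Qed.

End CanonicalFrameConditions.

Section FitchLogic.
Variable Atom : Type.
Implicit Types phi psi chi : form Atom.
Implicit Types s t r : list (entry Atom).

Lemma fitch_begins s : fitch_proof s -> exists phi, begins_with s phi.
Proof.
  induction 1;
    try (destruct IHfitch_proof as [a [r' Hr]]; exists a; rewrite Hr; eexists; reflexivity).
  - exists phi, []. reflexivity.
  - destruct IHfitch_proof1 as [a [r' Hr]]. exists a. rewrite Hr. eexists; reflexivity.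
Qed.

Lemma begins_with_app s t phi psi :
  begins_with s phi -> begins_with (s ++ t) psi -> begins_with s psi.
Proof.
  intros [r ->] [r' H]. injection H as -> _. exists r. reflexivity.
Qed.

Lemma ends_with_in s phi : ends_with s phi -> In (Fm phi) s.
Proof. intros [r ->]. apply in_or_app. right. left. reflexivity. Qed.

Definition sound_in (D : relation (form Atom)) s : Prop :=
  forall phi psi, begins_with s phi -> In (Fm psi) s -> D phi psi.

Lemma sound_in_snoc (D : relation (form Atom)) s psi :
  fitch_proof s -> sound_in D s ->
  (forall phi, begins_with s phi -> D phi psi) -> sound_in D (s ++ [Fm psi]).
Proof.
  intros Hp Hs Hpsi phi chi Hb Hin. destruct (fitch_begins Hp) as [a Ha].
  pose proof (begins_with_app Ha Hb) as Hb'.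
  apply in_app_or in Hin. destruct Hin as [Hin|[[= <-]|[]]]; auto.
Qed.

Lemma fitch_sound (D : relation (form Atom)) s :
  intro_elim D -> fitch_proof s ->
  sound_in D s /\ forall t, In (Sub t) s -> sound_in D t.
Proof.
  intros [HD [Hdni Hex]] Hs.
  assert (Hsub : forall s psi, (forall t, In (Sub t) s -> sound_in D t) ->
    forall t, In (Sub t) (s ++ [Fm psi]) -> sound_in D t).
  { intros s' psi H t Ht. apply in_app_or in Ht. destruct Ht as [Ht|[[=]|[]]]. auto. }
  induction Hs as [phi|s t Hs [IH IHs] Ht [IH' IHt]
    |s phi psi Hs [IH IHs] H1 H2|s phi psi Hs [IH IHs] H|s phi psi Hs [IH IHs] H
    |s phi psi Hs [IH IHs] H|s phi psi Hs [IH IHs] H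
    |s r t1 t2 phi psi chi Hs [IH IHs] H Heq Hb1 He1 Hb2 He2
    |s r t phi psi Hs [IH IHs] H Heq Hb He|s phi psi Hs [IH IHs] H1 H2];
    [| | split; [|exact (Hsub _ _ IHs)]; apply sound_in_snoc; auto; intros a Ha ..].
  - split.
    + intros a b [r [= <- _]] [[= <-]|[]]. exact (D_refl HD _).
    + intros t [[=]|[]].
  - split.
    + intros a b Hb Hin. destruct (fitch_begins Hs) as [c Hc].
      pose proof (begins_with_app Hc Hb).
      apply in_app_or in Hin. destruct Hin as [Hin|[[=]|[]]]. auto.
    + intros t' Hin. apply in_app_or in Hin. destruct Hin as [Hin|[[= <-]|[]]]; auto.
  - exact (D_and_intro HD (IH _ _ Ha H1) (IH _ _ Ha H2)).
  - exact (D_trans HD (IH _ _ Ha H) (D_and_l HD _ _)).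
  - exact (D_trans HD (IH _ _ Ha H) (D_and_r HD _ _)).
  - exact (D_trans HD (IH _ _ Ha H) (D_or_l HD _ _)).
  - exact (D_trans HD (IH _ _ Ha H) (D_or_r HD _ _)).
  - apply (D_trans HD (IH _ _ Ha H)). apply (D_or_elim HD).
    + apply (IHs t1); [|exact Hb1|exact (ends_with_in He1)].
      rewrite Heq. apply in_or_app. right. left. reflexivity.
    + apply (IHs t2); [|exact Hb2|exact (ends_with_in He2)].
      rewrite Heq. apply in_or_app. right. right. left. reflexivity.
  - apply (D_trans HD (IH _ _ Ha H)). apply (D_trans HD (Hdni psi)). apply (D_contra HD).
    apply (IHs t); [|exact Hb|exact (ends_with_in He)].
    rewrite Heq. apply in_or_app. right. left. reflexivity.
  - exact (D_trans HD (D_and_intro HD (IH _ _ Ha H1) (IH _ _ Ha H2)) (Hex _ _)).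
Qed.

Lemma entails_F_sound (D : relation (form Atom)) phi psi :
  intro_elim D -> entails_F phi psi -> D phi psi.
Proof.
  intros HD [s [Hs [Hb He]]].
  exact (proj1 (fitch_sound HD Hs) _ _ Hb (ends_with_in He)).
Qed.

Lemma app_tl_snoc s t e :
  fitch_proof t -> s ++ tl (t ++ [e]) = (s ++ tl t) ++ [e].
Proof.
  intros Ht. destruct (fitch_begins Ht) as [a [r ->]]. simpl. apply app_assoc.
Qed.

Lemma fitch_app s t phi :
  fitch_proof s -> In (Fm phi) s -> fitch_proof t -> begins_with t phi ->
  fitch_proof (s ++ tl t).
Proof.
  intros Hs Hphi Ht.
  assert (Hin : forall t, begins_with t phi -> forall psi,
    In (Fm psi) t -> In (Fm psi) (s ++ tl t)).
  { intros t' [r ->] psi [[= <-]|H]; apply in_or_app; auto. }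
  assert (Hbeg : forall t u, fitch_proof t -> begins_with (t ++ u) phi -> begins_with t phi).
  { intros t' u Ht' Hb. destruct (fitch_begins Ht') as [a Ha].
    exact (begins_with_app Ha Hb). }
  induction Ht; intros Hb;
    try (apply Hbeg in Hb; [|assumption]; rewrite app_tl_snoc by assumption).
  - simpl. rewrite app_nil_r. exact Hs.
  - apply fitch_sub; auto.
  - apply fitch_and_intro; auto.
  - eapply fitch_and_elim_l; eauto.
  - eapply fitch_and_elim_r; eauto.
  - apply fitch_or_intro_l; auto.
  - apply fitch_or_intro_r; auto.
  - eapply fitch_or_elim with (t1 := t1) (t2 := t2) (r := s ++ tl r); eauto.
    subst s0. destruct Hb as [q Hq]. destruct r; [discriminate|].
    simpl. apply app_assoc.
  - eapply fitch_neg_intro with (t := t) (r := s ++ tl r); eauto.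
    subst s0. destruct Hb as [q Hq]. destruct r; [discriminate|].
    simpl. apply app_assoc.
  - apply fitch_neg_elim with (phi := phi0); auto.
Qed.

Lemma begins_with_app_l s t phi : begins_with s phi -> begins_with (s ++ t) phi.
Proof. intros [r ->]. eexists. reflexivity. Qed.

Lemma ends_with_snoc s phi : ends_with (s ++ [Fm phi]) phi.
Proof. exists s. reflexivity. Qed.

Lemma entails_F_step phi psi :
  fitch_proof [Fm phi; Fm psi] -> entails_F phi psi.
Proof.
  intros H. exists [Fm phi; Fm psi]. split; [exact H|split].
  - exists [Fm psi]. reflexivity.
  - exists [Fm phi]. reflexivity.
Qed.

Lemma entails_F_trans phi psi chi :
  entails_F phi psi -> entails_F psi chi -> entails_F phi chi.
Proof.
  intros [s [Hs [Hbs Hes]]] [t [Ht [Hbt [r Hr]]]].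
  exists (s ++ tl t). split; [|split].
  - exact (fitch_app Hs (ends_with_in Hes) Ht Hbt).
  - apply begins_with_app_l. exact Hbs.
  - destruct Hbt as [q Hq]. subst t. destruct r as [|e r].
    + injection Hr as -> ->. simpl. rewrite app_nil_r. exact Hes.
    + injection Hr as _ ->. exists (s ++ r). apply app_assoc.
Qed.

Lemma entails_F_and_intro phi psi chi :
  entails_F phi psi -> entails_F phi chi -> entails_F phi (And psi chi).
Proof.
  intros [s [Hs [Hbs Hes]]] [t [Ht [Hbt Het]]].
  assert (Hphi : In (Fm phi) s) by (destruct Hbs as [r ->]; left; reflexivity).
  exists ((s ++ tl t) ++ [Fm (And psi chi)]).
  split; [|split; [|apply ends_with_snoc]].
  - apply fitch_and_intro.
    + exact (fitch_app Hs Hphi Ht Hbt).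
    + apply in_or_app. left. exact (ends_with_in Hes).
    + apply in_or_app. apply ends_with_in in Het. destruct Hbt as [r ->].
      destruct Het as [[= <-]|H]; auto.
  - do 2 apply begins_with_app_l. exact Hbs.
Qed.

Lemma entails_F_or_elim phi psi chi :
  entails_F phi chi -> entails_F psi chi -> entails_F (Or phi psi) chi.
Proof.
  intros [s [Hs [Hbs Hes]]] [t [Ht [Hbt Het]]].
  exists ([Fm (Or phi psi); Sub s; Sub t] ++ [Fm chi]).
  split; [|split; [eexists; reflexivity | apply ends_with_snoc]].
  apply fitch_or_elim with (r := [Fm (Or phi psi)]) (t1 := s) (t2 := t)
    (phi := phi) (psi := psi); auto.
  - apply (fitch_sub (s := [Fm (Or phi psi); Sub s])); [|exact Ht].
    apply (fitch_sub (s := [Fm (Or phi psi)])); [apply fitch_start | exact Hs].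
  - left. reflexivity.
Qed.

Lemma entails_F_neg_intro phi psi :
  entails_F phi (Neg psi) -> entails_F psi (Neg phi).
Proof.
  intros [s [Hs [Hbs Hes]]].
  exists ([Fm psi; Sub s] ++ [Fm (Neg phi)]).
  split; [|split; [eexists; reflexivity | apply ends_with_snoc]].
  apply fitch_neg_intro with (r := [Fm psi]) (t := s) (psi := psi); auto.
  - apply (fitch_sub (s := [Fm psi])); [apply fitch_start | exact Hs].
  - left. reflexivity.
Qed.

Lemma entails_F_refl phi : entails_F phi phi.
Proof.
  exists [Fm phi]. split; [apply fitch_start|split; exists []; reflexivity].
Qed.

Lemma entails_F_dni : dni (@entails_F Atom).
Proof. intros phi. apply entails_F_neg_intro. apply entails_F_refl. Qed.

Lemma entails_F_intro_elim : intro_elim (@entails_F Atom).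
Proof.
  split; [split|split].
  - exact entails_F_refl.
  - intros phi psi. apply entails_F_step.
    apply (fitch_and_elim_l (s := [Fm (And phi psi)]) (psi := psi) (fitch_start _)).
    left. reflexivity.
  - intros phi psi. apply entails_F_step.
    apply (fitch_and_elim_r (s := [Fm (And phi psi)]) (phi := phi) (fitch_start _)).
    left. reflexivity.
  - intros phi psi. apply entails_F_step.
    apply (fitch_or_intro_l (s := [Fm phi]) psi (fitch_start _)).
    left. reflexivity.
  - intros phi psi. apply entails_F_step.
    apply (fitch_or_intro_r (s := [Fm phi]) psi (fitch_start _)).
    left. reflexivity.
  - exact entails_F_trans.
  - exact entails_F_and_intro.
  - exact entails_F_or_elim.
  - intros phi psi H. apply entails_F_neg_intro.
    exact (entails_F_trans H (entails_F_dni psi)).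
  - exact entails_F_dni.
  - intros phi psi.
    exists (([Fm (And phi (Neg phi))] ++ [Fm phi]) ++ [Fm (Neg phi)] ++ [Fm psi]).
    split; [|split; [eexists; reflexivity | rewrite app_assoc; apply ends_with_snoc]].
    rewrite app_assoc. apply fitch_neg_elim with (phi := phi);
      [|simpl; auto|simpl; auto].
    apply fitch_and_elim_r with (phi := phi); [|simpl; auto].
    apply fitch_and_elim_l with (psi := Neg phi); [|simpl; auto].
    apply fitch_start.
Qed.

End FitchLogic.

Theorem theorem4p27 (Atom : Type) (p0 : Atom) (phi psi : form Atom) :
  (entails_pre phi psi <-> consequence all_frames phi psi) /\
  (entails_pro phi psi <-> consequence reflexive_frame phi psi) /\
  ((entails_para phi psi <-> consequence pseudosymmetric phi psi) /\
   (entails_para phi psi <-> consequence strongly_pseudosymmetric phi psi)) /\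
  ((entails_F phi psi <-> consequence class_PR phi psi) /\
   (entails_F phi psi <-> consequence class_SR phi psi)) /\
  (entails_psu p0 phi psi <-> consequence class_WCR phi psi).
Proof.
  assert (Hsp : forall F, strongly_pseudosymmetric F -> pseudosymmetric F).
  { intros F HF x y Hy. destruct (HF x y Hy) as [z [Hz [Hzx _]]]. eauto. }
  assert (Hpara : entails_para phi psi -> consequence pseudosymmetric phi psi).
  { intros H. apply H. split; [apply consequence_prelogic | apply consequence_dni; auto]. }
  assert (Hpara' : consequence strongly_pseudosymmetric phi psi -> entails_para phi psi).
  { intros H D [HD Hdni]. revert H. apply (prelogic_complete HD). intros w.
    exact (canonical_strongly_pseudosymmetric HD Hdni (fun _ => I)). }
  assert (HF : entails_F phi psi -> consequence class_PR phi psi).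
  { apply entails_F_sound. apply consequence_intro_elim. auto. }
  assert (HF' : consequence class_SR phi psi -> entails_F phi psi).
  { apply (protologic_complete (intro_elim_protologic (@entails_F_intro_elim Atom))).
    intros w. apply canonical_SR. apply entails_F_intro_elim. }
  pose proof (consequence_subclass (phi := phi) (psi := psi) Hsp) as Hsub.
  pose proof (consequence_subclass (phi := phi) (psi := psi) class_SR_PR) as Hsub'.
  split; [|split; [|split; [|split]]].
  - split.
    + intros H. apply H. apply consequence_prelogic.
    + intros H D HD. revert H. apply (prelogic_complete HD). intros w. exact I.
  - split.
    + intros H. apply H. split; [apply consequence_prelogic|split].
      * apply consequence_noncontradiction. auto.
      * apply consequence_explosion. auto.
    + intros H D HD. revert H. apply (protologic_complete HD).
      exact (canonical_reflexive (D := D)).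
  - split; split; auto.
  - split; split; auto.
  - split.
    + intros H. apply H. apply consequence_pseudocomplementary.
    + intros H D HD. revert H.
      apply (protologic_complete (intro_elim_protologic (proj1 HD))).
      intros w. exact (canonical_WCR w HD).
Qed.
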